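(* For every irrational $\alpha\in(0,1)$, the Bishop operator $T_\alpha$ on $L^2[0,1)$, given by $T_\alpha f(t)=t\,f(\{t+\alpha\})$, is biquasitriangular.
   Context: $\{\cdot\}$ denotes the fractional part. A bounded linear operator $T$ on a separable infinite-dimensional complex Hilbert space $H$ is called quasitriangular if there exists an increasing sequence $(P_n)_{n\ge1}$ of finite rank (orthogonal) projections converging strongly to the identity $I$ such that $\|TP_n-P_nTP_n\|\to0$ as $n\to\infty$. $T$ is called biquasitriangular if both $T$ and its adjoint $T^*$ are quasitriangular. *)

(* Defs.v *)
From HB Require Import structures.
From mathcomp Require Import all_boot all_order all_algebra.
From mathcomp Require Import generic_quotient ring_quotient.
From mathcomp Require Import all_classical all_reals all_analysis.
From mathcomp Require Import measurable_realfun complex ring lra.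

Set Implicit Arguments.
Unset Strict Implicit.
Unset Printing Implicit Defensive.

Import Order.TTheory GRing.Theory Num.Theory.
Import numFieldNormedType.Exports.
Local Open Scope classical_set_scope.
Local Open Scope ring_scope.
Local Open Scope complex_scope.
Local Open Scope quotient_scope.

(* Complex inner product spaces. The inner product is linear in its first
   argument; [<=] on R[i] is the partial order, so that [0 <= dot u u] says that
   [dot u u] is a nonnegative real. Completeness plays no role in the
   definitions below and is not part of the structure. *)
HB.mixin Record Lmodule_isInner (R : realType) V of GRing.Lmodule R[i] V := {
  dot : V -> V -> R[i];
  dot_linear : forall (a : R[i]) (u v w : V),
    dot (a *: u + v) w = a * dot u w + dot v w;
  dot_conj : forall u v : V, dot v u = (dot u v)^*;
  dot_ge0 : forall u : V, 0 <= dot u u;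
  dot_eq0 : forall u : V, dot u u = 0 -> u = 0
}.

#[short(type="innerType")]
HB.structure Definition Inner (R : realType) :=
  {V of Lmodule_isInner R V & GRing.Lmodule R[i] V}.

Section Operators.
Context {R : realType} {H : innerType R}.

Definition hnorm (x : H) : R := Num.sqrt (complex.Re (dot x x)).

(* Valued in \bar R, so that no boundedness assumption is needed. *)
Definition opnorm (A : H -> H) : \bar R :=
  ereal_sup [set (hnorm (A x))%:E | x in [set x | hnorm x <= 1]].

Definition bounded_operator (A : H -> H) :=
  exists M : R, forall x, hnorm (A x) <= M * hnorm x.

Definition adjoint_of (A B : H -> H) :=
  forall x y, dot (A x) y = dot x (B y).

Definition orthogonal_projection (P : {linear H -> H}) :=
  (forall x, P (P x) = P x) /\ adjoint_of P P.

Definition finite_rank (A : {linear H -> H}) :=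
  exists (n : nat) (e : 'I_n -> H), forall x, exists c : 'I_n -> R[i],
    A x = \sum_(i < n) c i *: e i.

(* For orthogonal projections, P <= Q amounts to the inclusion of the ranges. *)
Definition quasitriangular (T : {linear H -> H}) :=
  bounded_operator T /\
  exists P : nat -> {linear H -> H},
    [/\ forall n, orthogonal_projection (P n) /\ finite_rank (P n),
        forall n, range (P n) `<=` range (P n.+1),
        forall x, hnorm (P n x - x) @[n --> \oo] --> (0 : R)
      & opnorm (fun x => T (P n x) - P n (T (P n x))) @[n --> \oo] -->
          (0 : \bar R)].

Definition biquasitriangular (T : {linear H -> H}) :=
  quasitriangular T /\
  exists S : {linear H -> H}, adjoint_of T S /\ quasitriangular S.

End Operators.

Section L2.
Context (R : realType).
Local Notation mu := (@lebesgue_measure R).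
Local Notation I01 := `[0 : R, 1[%classic.
Implicit Types f g h : R -> R[i].

(* Elements of L^2[0,1) are represented by functions on the whole real line of
   which only the values on [0, 1[ matter. *)
Definition square_integrable f :=
  [/\ measurable_fun I01 (fun t => complex.Re (f t)),
      measurable_fun I01 (fun t => complex.Im (f t))
    & (\int[mu]_(t in I01) (complex.Re (f t) ^+ 2 + complex.Im (f t) ^+ 2)%:E
        < +oo)%E].

Definition integralC h : R[i] :=
  (\int[mu]_(t in I01) complex.Re (h t)) +i*
  (\int[mu]_(t in I01) complex.Im (h t)).

#[local] Instance ae_filter_lebesgue : Filter (almost_everywhere mu).
Proof. exact: ae_filter_ringOfSetsType. Qed.

Lemma measurable_I01 : measurable (I01 : set (measurableTypeR R)). Proof. exact: measurable_itv. Qed.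

Lemma sqint_comp f : square_integrable f ->
  mu.-integrable I01 (fun t => (complex.Re (f t) ^+ 2 + complex.Im (f t) ^+ 2)%:E).
Proof.
move=> [mr mi fi]; apply/integrableP; split.
  by apply/measurable_EFinP/measurable_funD; exact: measurable_funX.
by under eq_integral do rewrite gee0_abs ?lee_fin ?addr_ge0 ?sqr_ge0//.
Qed.

Lemma sqintP f :
  measurable_fun I01 (fun t => complex.Re (f t)) ->
  measurable_fun I01 (fun t => complex.Im (f t)) ->
  (exists2 g : R -> R, mu.-integrable I01 (EFin \o g) &
     forall t, complex.Re (f t) ^+ 2 + complex.Im (f t) ^+ 2 <= g t) ->
  square_integrable f.
Proof.
move=> mr mi [g gi fg]; split => //.
have /integrableP[mg goo] := gi.
apply: le_lt_trans goo; apply: ge0_le_integral => //.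
- by move=> t _; rewrite lee_fin addr_ge0 ?sqr_ge0.
- by apply/measurable_EFinP/measurable_funD; exact: measurable_funX.
- exact: measurableT_comp.
- by move=> t _; rewrite lee_fin (le_trans (fg t))// ler_norm.
Qed.

Definition sqint_pred : {pred R -> R[i]} := fun f => `[< square_integrable f >].

Lemma sqint_lin (a : R[i]) f g : square_integrable f -> square_integrable g ->
  square_integrable (fun t => a * f t + g t).
Proof.
move=> sf sg; have [mfr mfi _] := sf; have [mgr mgi _] := sg.
have fi := sqint_comp sf; have gi := sqint_comp sg.
case: a => a b; apply: sqintP.
- have -> : (fun t => complex.Re ((a +i* b) * f t + g t)) =
     (fun t => a * complex.Re (f t) - b * complex.Im (f t) + complex.Re (g t)).
    by apply/funext => t; case: (f t) (g t) => [? ?] [].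
  by apply: measurable_funD => //; apply: measurable_funB; exact: measurable_funM.
- have -> : (fun t => complex.Im ((a +i* b) * f t + g t)) =
     (fun t => a * complex.Im (f t) + b * complex.Re (f t) + complex.Im (g t)).
    by apply/funext => t; case: (f t) (g t) => [? ?] [].
  by apply: measurable_funD => //; apply: measurable_funD; exact: measurable_funM.
exists (fun t => (2 * (a ^+ 2 + b ^+ 2)) * (complex.Re (f t) ^+ 2 + complex.Im (f t) ^+ 2)
    + 2 * (complex.Re (g t) ^+ 2 + complex.Im (g t) ^+ 2)).
  have -> : (EFin \o (fun t => (2 * (a ^+ 2 + b ^+ 2)) * (complex.Re (f t) ^+ 2 + complex.Im (f t) ^+ 2)
    + 2 * (complex.Re (g t) ^+ 2 + complex.Im (g t) ^+ 2))) =
   (fun t => (2 * (a ^+ 2 + b ^+ 2))%:E * (complex.Re (f t) ^+ 2 + complex.Im (f t) ^+ 2)%:E)%E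
   \+ (fun t => 2%:E * (complex.Re (g t) ^+ 2 + complex.Im (g t) ^+ 2)%:E)%E.
    by apply/funext => t /=; rewrite EFinD !EFinM.
  by apply: integrableD => //; apply: integrableZl.
move=> t; case: (f t) (g t) => [x y] [z w] /=.
rewrite -subr_ge0.
have -> : 2 * (a ^+ 2 + b ^+ 2) * (x ^+ 2 + y ^+ 2) + 2 * (z ^+ 2 + w ^+ 2) -
  ((a * x - b * y + z) ^+ 2 + (a * y + b * x + w) ^+ 2)
  = (a * x - b * y - z) ^+ 2 + (a * y + b * x - w) ^+ 2 by ring.
by rewrite addr_ge0 ?sqr_ge0.
Qed.

Lemma sqint0 : square_integrable (fun _ => 0).
Proof.
by split => /=; rewrite ?expr0n/= ?addr0 ?integral0.
Qed.

Lemma sqint_zmod_closed : zmod_closed sqint_pred.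
Proof.
split; first by apply/asboolP; exact: sqint0.
move=> f g /asboolP sf /asboolP sg; apply/asboolP.
rewrite (_ : f - g = fun t => (-1) * g t + f t); first exact: sqint_lin.
by apply/funext => t; rewrite mulN1r addrC.
Qed.
HB.instance Definition _ :=
  GRing.isZmodClosed.Build (R -> R[i]) sqint_pred sqint_zmod_closed.

Record L2fun := MkL2fun { L2val :> R -> R[i]; _ : L2val \in sqint_pred }.
HB.instance Definition _ := [isSub for L2val].
HB.instance Definition _ := [Choice of L2fun by <:].
HB.instance Definition _ := [SubChoice_isSubZmodule of L2fun by <:].

Lemma L2funP (u : L2fun) : square_integrable u.
Proof. by case: u => f /= /asboolP. Qed.

Definition toL2fun f (sf : square_integrable f) : L2fun :=
  MkL2fun (introT (asboolP _) sf).

Definition L2null : {pred L2fun} :=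
  fun u => `[< (u : R -> R[i]) = (fun _ => 0) %[ae mu in I01] >].

Lemma L2null_zmod_closed : zmod_closed L2null.
Proof.
split; first by apply/asboolP; exact: aeW.
move=> u v /asboolP u0 /asboolP v0; apply/asboolP.
by apply: filterS2 u0 v0 => t u0 v0 tI; change (u t - v t = 0); rewrite u0// v0// subr0.
Qed.
HB.instance Definition _ :=
  GRing.isZmodClosed.Build L2fun L2null L2null_zmod_closed.

(* L^2[0,1): square integrable functions modulo almost everywhere equality. *)
Definition L2 : Type := Quotient.quot L2null.
HB.instance Definition _ := Choice.on L2.
HB.instance Definition _ := EqQuotient.on L2.
HB.instance Definition _ := GRing.Zmodule.on L2.

Definition L2class (u : L2fun) : L2 := \pi_L2 u.

Lemma L2class_repr (x : L2) : L2class (repr x) = x.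
Proof. exact: reprK. Qed.

Lemma L2classP (u v : L2fun) :
  L2class u = L2class v <-> (u : R -> R[i]) = v %[ae mu in I01].
Proof.
split=> [/eqP|uv].
  rewrite -[_ == _]/(u == v %[mod Quotient.quot L2null]) -Quotient.idealrBE.
  by move=> /asboolP; apply: filterS => t /[apply] /= /eqP; rewrite subr_eq0 => /eqP.
apply/eqP; rewrite -[_ == _]/(u == v %[mod Quotient.quot L2null]) -Quotient.idealrBE.
by apply/asboolP; apply: filterS uv => t uv tI; change (u t - v t = 0); rewrite uv// subrr.
Qed.

Lemma L2repr_class (u : L2fun) :
  (repr (L2class u) : R -> R[i]) = u %[ae mu in I01].
Proof. by apply/L2classP; rewrite L2class_repr. Qed.

Lemma L2classD (u v : L2fun) : L2class (u + v) = L2class u + L2class v.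
Proof. exact: Quotient.pi_add. Qed.

Lemma L2class0 : L2class 0 = 0.
Proof. by apply: (addIr (L2class 0)); rewrite -L2classD !add0r. Qed.

Lemma sqintZ (a : R[i]) f : square_integrable f ->
  square_integrable (fun t => a * f t).
Proof.
move=> sf; have := sqint_lin a sf sqint0.
by congr square_integrable; apply/funext => t; rewrite addr0.
Qed.

Definition L2fun_scale (a : R[i]) (u : L2fun) : L2fun :=
  toL2fun (sqintZ a (L2funP u)).

Definition L2scale (a : R[i]) (x : L2) : L2 := L2class (L2fun_scale a (repr x)).

Lemma L2scaleE a u : L2scale a (L2class u) = L2class (L2fun_scale a u).
Proof.
apply/L2classP; have := L2repr_class u.
by apply: filterS => t /[apply] /= ->.
Qed.

Lemma L2scaleA a b x : L2scale a (L2scale b x) = L2scale (a * b) x.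
Proof.
rewrite -[x]L2class_repr !L2scaleE; apply/L2classP/aeW => t _ /=.
by rewrite mulrA.
Qed.

Lemma L2scale1 : left_id 1 L2scale.
Proof.
move=> x; rewrite -[x]L2class_repr !L2scaleE; apply/L2classP/aeW => t _ /=.
by rewrite mul1r.
Qed.

Lemma L2scaleDr : right_distributive L2scale +%R.
Proof.
move=> a x y; rewrite -[x]L2class_repr -[y]L2class_repr -L2classD !L2scaleE.
by rewrite -L2classD; apply/L2classP/aeW => t _ /=; rewrite mulrDr.
Qed.

Lemma L2scaleDl x : {morph L2scale^~ x : a b / a + b}.
Proof.
move=> a b; rewrite -[x]L2class_repr !L2scaleE.
by rewrite -L2classD; apply/L2classP/aeW => t _ /=; rewrite mulrDl.
Qed.

HB.instance Definition _ :=
  GRing.Zmodule_isLmodule.Build R[i] L2 L2scaleA L2scale1 L2scaleDr L2scaleDl.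

Lemma L2classZ a u : L2class (L2fun_scale a u) = a *: L2class u.
Proof. by rewrite -L2scaleE. Qed.

Definition integrableC h :=
  mu.-integrable I01 (fun t => (complex.Re (h t))%:E) /\
  mu.-integrable I01 (fun t => (complex.Im (h t))%:E).

Lemma integralC_lin a h k : integrableC h -> integrableC k ->
  integralC (fun t => a * h t + k t) = a * integralC h + integralC k.
Proof.
move=> [hr hi] [kr ki]; case: a => a b; rewrite /integralC.
have HD (p q r : measurableTypeR R -> R) s t w :
  mu.-integrable I01 (fun t => (p t)%:E) ->
  mu.-integrable I01 (fun t => (q t)%:E) ->
  mu.-integrable I01 (fun t => (r t)%:E) ->
  s = \int[mu]_(t in I01) p t -> t = \int[mu]_(t in I01) q t ->
  w = \int[mu]_(t in I01) r t ->
  forall x y : R, \int[mu]_(t in I01) (x * p t + y * q t + r t) =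
   x * s + y * t + w.
  move=> ip iq ir -> -> -> x y.
  have ixp : mu.-integrable I01 (EFin \o (fun t => x * p t)).
    exact: (integrableZl measurable_I01 x ip).
  have iyq : mu.-integrable I01 (EFin \o (fun t => y * q t)).
    exact: (integrableZl measurable_I01 y iq).
  rewrite RintegralD//; last by have := integrableD measurable_I01 ixp iyq.
  by rewrite RintegralD// !RintegralZl.
congr (_ +i* _).
- rewrite -mulNr -(HD _ _ _ _ _ _ hr hi kr erefl erefl erefl).
  by apply: eq_Rintegral => t _; case: (h t) (k t) => [? ?] []//= *; rewrite mulNr.
- rewrite addrC -[in RHS]addrC -(HD _ _ _ _ _ _ hi hr ki erefl erefl erefl).
  by apply: eq_Rintegral => t _; case: (h t) (k t) => [? ?] [].
Qed.

Lemma ae_eq_integralC h k : integrableC h -> integrableC k ->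
  h = k %[ae mu in I01] -> integralC h = integralC k.
Proof.
move=> [hr hi] [kr ki] hk; rewrite /integralC /Rintegral.
congr (fine _ +i* fine _).
- apply: ae_eq_integral => //; [by case/integrableP: hr|by case/integrableP: kr|].
  by apply: filterS hk => t /[apply] ->.
- apply: ae_eq_integral => //; [by case/integrableP: hi|by case/integrableP: ki|].
  by apply: filterS hk => t /[apply] ->.
Qed.

Lemma sqint_mulJ f g : square_integrable f -> square_integrable g ->
  integrableC (fun t => f t * (g t)^*).
Proof.
move=> sf sg; have [mfr mfi _] := sf; have [mgr mgi _] := sg.
have bnd : mu.-integrable I01 (fun t =>
    ((complex.Re (f t) ^+ 2 + complex.Im (f t) ^+ 2) +
     (complex.Re (g t) ^+ 2 + complex.Im (g t) ^+ 2))%:E).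
  exact: (integrableD measurable_I01 (sqint_comp sf) (sqint_comp sg)).
split; apply: le_integrable bnd => //.
- apply/measurable_EFinP.
  have -> : (fun t => complex.Re (f t * (g t)^*)) = (fun t =>
     complex.Re (f t) * complex.Re (g t) + complex.Im (f t) * complex.Im (g t)).
    by apply/funext => t; case: (f t) (g t) => [? ?] [? ?] /=; ring.
  by apply: measurable_funD; exact: measurable_funM.
- move=> t _; rewrite lee_fin; case: (f t) (g t) => [x y] [z w] /=.
  rewrite [leRHS]ger0_norm ?addr_ge0 ?sqr_ge0//.
  have := (sqr_ge0 (x - z), sqr_ge0 (y - w), sqr_ge0 (x + z), sqr_ge0 (y + w)).
  by move=> [[[? ?] ?] ?]; rewrite ler_norml; apply/andP; split; nra.
- apply/measurable_EFinP.
  have -> : (fun t => complex.Im (f t * (g t)^*)) = (fun t =>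
     complex.Im (f t) * complex.Re (g t) - complex.Re (f t) * complex.Im (g t)).
    by apply/funext => t; case: (f t) (g t) => [? ?] [? ?] /=; ring.
  by apply: measurable_funB; exact: measurable_funM.
- move=> t _; rewrite lee_fin; case: (f t) (g t) => [x y] [z w] /=.
  rewrite [leRHS]ger0_norm ?addr_ge0 ?sqr_ge0//.
  have := (sqr_ge0 (x - w), sqr_ge0 (y - z), sqr_ge0 (x + w), sqr_ge0 (y + z)).
  by move=> [[[? ?] ?] ?]; rewrite ler_norml; apply/andP; split; nra.
Qed.

Definition L2dot (x y : L2) : R[i] := integralC (fun t => repr x t * (repr y t)^*).

Lemma L2dotE (u v : L2fun) :
  L2dot (L2class u) (L2class v) = integralC (fun t => u t * (v t)^*).
Proof.
apply: ae_eq_integralC; [exact: sqint_mulJ (L2funP _) (L2funP _)..|].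
by apply: filterS2 (L2repr_class u) (L2repr_class v) => t + + tI => -> // ->.
Qed.

Lemma L2dot_linear (a : R[i]) (x y z : L2) :
  L2dot (a *: x + y) z = a * L2dot x z + L2dot y z.
Proof.
rewrite -[x]L2class_repr -[y]L2class_repr -[z]L2class_repr.
rewrite -L2classZ -L2classD !L2dotE -integralC_lin; last 2 first.
  exact: sqint_mulJ (L2funP _) (L2funP _).
  exact: sqint_mulJ (L2funP _) (L2funP _).
by congr integralC; apply/funext => t /=; rewrite mulrDl mulrA.
Qed.

Lemma L2dot_conj (x y : L2) : L2dot y x = (L2dot x y)^*.
Proof.
rewrite /L2dot /integralC /=; congr (_ +i* _).
  apply: eq_Rintegral => t _.
  by case: (repr x t) (repr y t) => [? ?] [? ?] /=; ring.
have [_ int] := sqint_mulJ (L2funP (repr x)) (L2funP (repr y)).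
rewrite -mulN1r -RintegralZl//; apply: eq_Rintegral => t _.
by case: (repr x t) (repr y t) => [? ?] [? ?] /=; ring.
Qed.

Lemma L2dotxx (u : L2fun) : integralC (fun t => u t * (u t)^*) =
  (\int[mu]_(t in I01) (complex.Re (u t) ^+ 2 + complex.Im (u t) ^+ 2))%:C.
Proof.
rewrite /integralC; congr (_ +i* _).
  by apply: eq_Rintegral => t _; case: (u t) => ? ? /=; ring.
rewrite /Rintegral integral0_eq// => t _; congr EFin.
by case: (u t) => ? ? /=; ring.
Qed.

Lemma L2dot_ge0 (x : L2) : 0 <= L2dot x x.
Proof.
by rewrite /L2dot L2dotxx ler0c Rintegral_ge0// => t _; rewrite addr_ge0 ?sqr_ge0.
Qed.

Lemma L2dot_eq0 (x : L2) : L2dot x x = 0 -> x = 0.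
Proof.
rewrite /L2dot L2dotxx => -[x0].
have [mr mi xoo] := L2funP (repr x).
have : (\int[mu]_(t in I01) `|(complex.Re (repr x t) ^+ 2 + complex.Im (repr x t) ^+ 2)%:E| = 0)%E.
  under eq_integral do rewrite gee0_abs ?lee_fin ?addr_ge0 ?sqr_ge0//.
  rewrite -[LHS]fineK; first by congr EFin.
  by rewrite ge0_fin_numE// integral_ge0// => t _; rewrite lee_fin addr_ge0 ?sqr_ge0.
move=> /(ae_eq_integral_abs mu measurable_I01) H.
rewrite -[x]L2class_repr -L2class0; apply/L2classP.
have mS : measurable_fun (I01 : set (measurableTypeR R))
    (fun t => (complex.Re (repr x t) ^+ 2 + complex.Im (repr x t) ^+ 2)%:E).
  by apply/measurable_EFinP/measurable_funD; exact: measurable_funX.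
apply: filterS (H mS) => t + tI => /(_ tI) /= [] /eqP.
rewrite paddr_eq0 ?sqr_ge0// !sqrf_eq0; case: (repr x t) => a b /=.
by move=> /andP[/eqP -> /eqP ->].
Qed.

HB.instance Definition _ := Lmodule_isInner.Build R L2
  L2dot_linear L2dot_conj L2dot_ge0 L2dot_eq0.


Definition frac (x : R) : R := x - (Num.floor x)%:~R.

Definition bishop_fun (alpha : R) f : R -> R[i] :=
  fun t => t%:C * f (frac (t + alpha)).

Lemma frac_itv x : 0 <= frac x < 1.
Proof.
have := floor_itv x; rewrite intrD mulr1z /frac.
by move=> /andP[? ?]; apply/andP; split; lra.
Qed.

Lemma fracDfrac t alpha : frac (t + alpha) = frac (t + frac alpha).
Proof.
rewrite /frac; set k := Num.floor alpha.
have -> : t + (alpha - k%:~R) = (t + alpha) + (- k)%:~R by rewrite intrN addrA.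
by rewrite (floorDrz (t + alpha) (intr_int _ (- k))) intrKfloor intrD intrN; ring.
Qed.

Lemma frac_lo t b : 0 <= t + b -> t + b < 1 -> frac (t + b) = t + b.
Proof.
by move=> t0 t1; rewrite /frac (@floor_def _ _ 0) ?subr0// t0.
Qed.

Lemma frac_hi t b : 1 <= t + b -> t + b < 2 -> frac (t + b) = t + (b - 1).
Proof.
by move=> t0 t1; rewrite /frac (@floor_def _ _ 1) ?addrA// t0.
Qed.

Definition shiftr (c : R) : measurableTypeR R -> measurableTypeR R :=
  fun t => t + c.

Lemma measurable_shiftr c : measurable_fun setT (shiftr c).
Proof. exact: measurable_funD. Qed.

Lemma shiftr_preimage c x y : shiftr c @^-1` `[x, y[ = `[x - c, y - c[%classic.
Proof.
by apply/seteqP; split => t /=; rewrite !in_itv/= lerBlDr ltrBrDr.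
Qed.

Lemma lebesgue_measure_shiftr c (A : set (measurableTypeR R)) :
  measurable A -> mu (shiftr c @^-1` A) = mu A.
Proof.
move=> mA; rewrite -[LHS]/(pushforward mu (shiftr c) A).
have mphi := isMeasurableFun.Build _ _ _ _ _ (measurable_shiftr c).
pose phi : {mfun measurableTypeR R >-> measurableTypeR R} := HB.pack (shiftr c) mphi.
apply/esym; apply: (@lebesgue_measure_unique _ (pushforward mu phi)) => //.
move=> _ [[a b]] _ <-.
rewrite [RHS](_ : _ = mu `]a - c, b - c]%classic); last first.
  congr (mu _); by apply/seteqP; split => t /=; rewrite /shiftr !in_itv/= ltrBlDr lerBrDr.
rewrite !lebesgue_measure_itv/= !lte_fin ltrD2r; case: ifP => // _.
by rewrite -!EFinB; congr EFin; lra.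
Qed.

Lemma ge0_integral_shiftr c (x y : R) (g : measurableTypeR R -> \bar R) :
  measurable_fun (`[x, y[%classic : set (measurableTypeR R)) g ->
  (forall t, 0 <= g t)%E ->
  (\int[mu]_(t in `[(x - c)%R, (y - c)%R[) g (t + c)%R =
   \int[mu]_(t in `[x, y[) g t)%E.
Proof.
move=> mg g0; rewrite -shiftr_preimage.
rewrite -(ge0_integral_pushforward (measurable_shiftr c) mu (D := `[x, y[%classic))//.
apply: eq_measure_integral => [|? A mA _]; first exact: measurable_shiftr.
exact: lebesgue_measure_shiftr.
Qed.

Lemma I01_split (b : R) : 0 <= b < 1 ->
  I01 = `[0, 1 - b[%classic `|` `[1 - b, 1[%classic.
Proof.
move=> /andP[b0 b1]; apply/seteqP; split => t /=; rewrite !in_itv/=.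
  by move=> /andP[-> ->]; rewrite andbT /=; case: (ltP t (1 - b)) => _; [left|right].
by move=> [/andP[? ?]|/andP[? ?]]; apply/andP; split; lra.
Qed.

Lemma measurable_rot (alpha : R) (g : R -> R) :
  measurable_fun I01 g -> measurable_fun I01 (fun t => g (frac (t + alpha))).
Proof.
move=> mg; set b := frac alpha; have b01 : 0 <= b < 1 := frac_itv alpha.
have /andP[b0 b1] := b01.
rewrite (I01_split b01); apply/measurable_funU => //; split.
- apply: (eq_measurable_fun (g \o shiftr b)).
    move=> t /set_mem /=; rewrite in_itv/= => /andP[t0 t1].
    by rewrite /shiftr fracDfrac -/b frac_lo//; lra.
  apply: (measurable_comp (F := I01)) => //.
    move=> _ [t /= + <-]; rewrite !in_itv/= /shiftr => /andP[t0 t1].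
    by apply/andP; split; lra.
  exact: measurable_funS (measurable_shiftr b).
- apply: (eq_measurable_fun (g \o shiftr (b - 1))).
    move=> t /set_mem /=; rewrite in_itv/= => /andP[t0 t1].
    by rewrite /shiftr fracDfrac -/b frac_hi//; lra.
  apply: (measurable_comp (F := I01)) => //.
    move=> _ [t /= + <-]; rewrite !in_itv/= /shiftr => /andP[t0 t1].
    by apply/andP; split; lra.
  exact: measurable_funS (measurable_shiftr (b - 1)).
Qed.

Lemma integral_rot_lty (alpha : R) (g : R -> R) :
  measurable_fun I01 g -> (forall t, 0 <= g t) ->
  (\int[mu]_(t in I01) (g t)%:E < +oo)%E ->
  (\int[mu]_(t in I01) (g (frac (t + alpha)))%:E < +oo)%E.
Proof.
move=> mg g0 goo; set b := frac alpha.
have b01 : 0 <= b < 1 := frac_itv alpha.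
have /andP[b0 b1] := b01.
have mr := measurable_rot alpha mg.
have sub (x y : R) : 0 <= x -> y <= 1 ->
    measurable_fun (`[x, y[%classic : set (measurableTypeR R)) (EFin \o g) /\
    (\int[mu]_(t in `[x, y[) (g t)%:E < +oo)%E.
  move=> x0 y1.
  have xyI : (`[x, y[%classic : set (measurableTypeR R)) `<=` I01.
    by move=> t /=; rewrite !in_itv/= => /andP[? ?]; apply/andP; split; lra.
  split; first by apply/measurable_EFinP; exact: measurable_funS mg.
  apply: le_lt_trans goo; apply: ge0_subset_integral => //.
  - exact/measurable_EFinP.
  - by move=> t _; rewrite lee_fin.
have [m1 o1] := sub b 1 b0 (lexx 1).
have [m2 o2] := sub 0 b (lexx 0) (ltW b1).
have h0 (t : measurableTypeR R) : (0 <= (EFin \o g) t)%E by rewrite lee_fin.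
have lo (t : R) : 0 <= t -> t < 1 - b -> frac (t + alpha) = t + b.
  by clear -b0 b1 => t0 t1; rewrite fracDfrac -/b frac_lo//; lra.
have hi (t : R) : 1 - b <= t -> t < 1 -> frac (t + alpha) = t + (b - 1).
  by clear -b0 b1 => t0 t1; rewrite fracDfrac -/b frac_hi//; lra.
rewrite (I01_split b01).
rewrite ge0_integral_setU//=; last 3 first.
- by rewrite -(I01_split b01); exact/measurable_EFinP.
- by move=> t _; rewrite lee_fin.
- rewrite disj_set2E; apply/eqP/seteqP; split => t //=.
  rewrite !in_itv/= => -[/andP[_ h1] /andP[h2 _]].
  by move: (lt_le_trans h1 h2); rewrite ltxx.
apply: lte_add_pinfty.
- have e := ge0_integral_shiftr b m1 h0.
  rewrite subrr in e; rewrite [X in (X < _)%E](_ : _ = \int[mu]_(t in `[b, 1%R[) (EFin \o g) t)%E//.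
  rewrite -e; apply: eq_integral => t /set_mem /=; rewrite in_itv/= => /andP[t0 t1].
  by congr (g _)%:E; apply: lo.
- have e := ge0_integral_shiftr (b - 1) m2 h0.
  have e1 : 0 - (b - 1) = 1 - b by ring.
  have e2 : b - (b - 1) = 1 by ring.
  rewrite e1 e2 in e.
  rewrite [X in (X < _)%E](_ : _ = \int[mu]_(t in `[0%R, b[) (EFin \o g) t)%E//.
  rewrite -e; apply: eq_integral => t /set_mem /=; rewrite in_itv/= => /andP[t0 t1].
  by congr (g _)%:E; apply: hi.
Qed.

Lemma sqint_bishop alpha f : square_integrable f ->
  square_integrable (bishop_fun alpha f).
Proof.
move=> [mr mi foo]; split; rewrite /bishop_fun.
- have -> : (fun t => complex.Re (t%:C * f (frac (t + alpha)))) =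
      (fun t => t * complex.Re (f (frac (t + alpha)))).
    by apply/funext => t; case: (f _) => ? ? /=; ring.
  apply: measurable_funM => //.
  exact: (measurable_rot alpha (g := fun t => complex.Re (f t))).
- have -> : (fun t => complex.Im (t%:C * f (frac (t + alpha)))) =
      (fun t => t * complex.Im (f (frac (t + alpha)))).
    by apply/funext => t; case: (f _) => ? ? /=; ring.
  apply: measurable_funM => //.
  exact: (measurable_rot alpha (g := fun t => complex.Im (f t))).
have mS : measurable_fun I01 (fun t => complex.Re (f t) ^+ 2 + complex.Im (f t) ^+ 2).
  by apply: measurable_funD; exact: measurable_funX.
have g0 t : 0 <= complex.Re (f t) ^+ 2 + complex.Im (f t) ^+ 2.
  by rewrite addr_ge0 ?sqr_ge0.
have := integral_rot_lty alpha mS g0 foo.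
apply: le_lt_trans; apply: ge0_le_integral => //.
- by move=> t _; rewrite lee_fin addr_ge0 ?sqr_ge0.
- have -> : (fun t => (complex.Re (t%:C * f (frac (t + alpha))) ^+ 2 +
      complex.Im (t%:C * f (frac (t + alpha))) ^+ 2)%:E) =
      (fun t => (t ^+ 2 * (complex.Re (f (frac (t + alpha))) ^+ 2 +
      complex.Im (f (frac (t + alpha))) ^+ 2))%:E).
    by apply/funext => t; case: (f _) => ? ? /=; congr EFin; ring.
  apply/measurable_EFinP/measurable_funM; first exact: measurable_funX.
  exact: (measurable_rot alpha mS).
- by apply/measurable_EFinP; exact: (measurable_rot alpha mS).
move=> t /=; rewrite in_itv/= => /andP[t0 t1]; rewrite lee_fin.
move: (g0 (frac (t + alpha))); case: (f _) => x y /= xy0.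
have -> : (t * x - 0 * y) ^+ 2 + (t * y + 0 * x) ^+ 2 =
  t ^+ 2 * (x ^+ 2 + y ^+ 2) by ring.
by rewrite ler_piMl// expr_le1// ltW.
Qed.

Lemma ae_bishop alpha f g : f = g %[ae mu in I01] ->
  bishop_fun alpha f = bishop_fun alpha g %[ae mu in I01].
Proof.
move=> [N [mN N0 fgN]]; set b := frac alpha.
have b01 : 0 <= b < 1 := frac_itv alpha.
have /andP[b0 b1] := b01.
have nS c : mu.-negligible (shiftr c @^-1` N).
  exists (shiftr c @^-1` N); split => //; last by rewrite lebesgue_measure_shiftr.
  by rewrite -[X in measurable X]setTI; exact: measurable_shiftr.
apply: negligibleS (negligibleU (nS b) (nS (b - 1))) => t /= /not_implyP[tI tN].
have NP s : I01 s -> f s <> g s -> N s.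
  by move=> sI fg; apply: fgN => /= /(_ sI).
have rI : I01 (frac (t + alpha)) by rewrite /= in_itv/= frac_itv.
have {}tN : N (frac (t + alpha)).
  by apply: NP => // fg; apply: tN; rewrite /bishop_fun fg.
move: tI; rewrite /= in_itv/= => /andP[t0 t1].
rewrite /shiftr; have [tb|tb] := ltP (t + b) 1.
  by left; move: tN; rewrite fracDfrac -/b frac_lo//; lra.
by right; move: tN; rewrite fracDfrac -/b frac_hi//; lra.
Qed.

(* [bishop_class] shows that the choice of a representative is immaterial. *)
Definition bishop (alpha : R) (x : L2) : L2 :=
  L2class (toL2fun (sqint_bishop alpha (L2funP (repr x)))).

Lemma bishop_class alpha (u : L2fun) :
  bishop alpha (L2class u) = L2class (toL2fun (sqint_bishop alpha (L2funP u))).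
Proof. by apply/L2classP; apply: ae_bishop; exact: L2repr_class. Qed.

Lemma bishop_linear alpha : linear (bishop alpha).
Proof.
move=> a x y; rewrite -[x]L2class_repr -[y]L2class_repr.
rewrite -L2classZ -L2classD !bishop_class -L2classZ -L2classD.
by apply/L2classP/aeW => t _; rewrite /= /bishop_fun /= mulrDr mulrCA.
Qed.
HB.instance Definition _ alpha :=
  GRing.isLinear.Build R[i] L2 L2 *:%R (bishop alpha) (bishop_linear alpha).

End L2.

(* Main.v *)
(* The weight [t] of the Bishop operator is small near [0], and, as [alpha] is
   irrational, every orbit of the rotation enters [0, eps[ within a number N of
   steps that depends on [eps] only. Replacing the weight by [0] on [0, eps[
   therefore changes the operator by at most [eps] in norm and makes its N-th
   power vanish. The adjoint is again a weighted rotation, by [- alpha] and with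
   weight [frac (t - alpha)], to which the same argument applies. So both are
   norm limits of nilpotent operators. If A is nilpotent, the finite-dimensional
   A-invariant subspaces are cofinal among all finite-dimensional ones (add the
   vectors A^j v to a spanning family), which gives the increasing sequence of
   projections. *)

From HB Require Import structures.
Require Import Defs.
From mathcomp Require Import all_boot all_order all_algebra.
From mathcomp Require Import all_classical all_reals all_analysis.
From mathcomp Require Import measurable_realfun complex ring lra.
(* [fraction] also exports a [frac], which would shadow that of [Defs]. *)
Import Defs.

Set Implicit Arguments.
Unset Strict Implicit.
Unset Printing Implicit Defensive.

Import Order.TTheory GRing.Theory Num.Theory.
Import numFieldNormedType.Exports.
Import HBNNSimple.

Local Open Scope classical_set_scope.
Local Open Scope ring_scope.

(** * Squared modulus of a complex number, the integrand of the squared L^2 norm *)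

Section SquaredModulus.
Context {R : realType}.
Implicit Types (z w : R[i]) (s t : R).

Definition sqmod z : R := complex.Re z ^+ 2 + complex.Im z ^+ 2.

Lemma sqmod_ge0 z : 0 <= sqmod z. Proof. by rewrite addr_ge0 ?sqr_ge0. Qed.

Lemma sqmodM z w : sqmod (z * w) = sqmod z * sqmod w.
Proof. by case: z w => [? ?] [? ?]; rewrite /sqmod /=; ring. Qed.

Lemma sqmod_real s : sqmod (s%:C)%C = s ^+ 2.
Proof. by rewrite /sqmod /= expr0n addr0. Qed.

Lemma sqmod_realB s t : sqmod ((s%:C)%C - (t%:C)%C) = (s - t) ^+ 2.
Proof. by rewrite -rmorphB sqmod_real. Qed.

End SquaredModulus.

(** * Limits of nilpotent operators *)

Section InnerProduct.
Context {R : realType} {H : innerType R}.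
Local Open Scope complex_scope.
Implicit Types (x y z : H) (a : R[i]).

Lemma conjcM a b : (a * b)^*%C = a^*%C * b^*%C.
Proof. exact: rmorphM. Qed.

Lemma dotDl x y z : dot (x + y) z = dot x z + dot y z.
Proof. by rewrite -{1}[x]scale1r dot_linear mul1r. Qed.

Lemma dot0l z : dot 0 z = 0.
Proof. by apply: (addIr (dot 0 z)); rewrite -dotDl !add0r. Qed.

Lemma dotZl a x z : dot (a *: x) z = a * dot x z.
Proof. by rewrite -[a *: x]addr0 dot_linear dot0l addr0. Qed.

Lemma dotNl x z : dot (- x) z = - dot x z.
Proof. by rewrite -scaleN1r dotZl mulN1r. Qed.

Lemma dotDr x y z : dot x (y + z) = dot x y + dot x z.
Proof. by rewrite dot_conj dotDl rmorphD /= -!dot_conj. Qed.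

Lemma dotZr a x z : dot x (a *: z) = a^*%C * dot x z.
Proof. by rewrite dot_conj dotZl rmorphM /= -dot_conj. Qed.

Lemma dotNr x z : dot x (- z) = - dot x z.
Proof. by rewrite dot_conj dotNl rmorphN /= -dot_conj. Qed.

Lemma dot0r x : dot x 0 = 0.
Proof. by rewrite dot_conj dot0l conjc0. Qed.

(** Estimates are carried out on squared norms, which avoids square roots; [sqnormD_le] then stands
    in for the triangle inequality. *)
Definition sqnorm x : R := complex.Re (dot x x).

Lemma dotxx x : dot x x = (sqnorm x)%:C.
Proof.
have := dot_ge0 x; rewrite /sqnorm; case: (dot x x) => p q.
by rewrite lecE /= => /andP[/eqP ->].
Qed.

Lemma sqnorm_ge0 x : 0 <= sqnorm x.
Proof. by have := dot_ge0 x; rewrite dotxx ler0c. Qed.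

Lemma sqnorm0 : sqnorm 0 = 0. Proof. by rewrite /sqnorm dot0l. Qed.

Lemma sqnorm_eq0 x : sqnorm x <= 0 -> x = 0.
Proof.
move=> x0; apply: dot_eq0; rewrite dotxx.
by have -> : sqnorm x = 0 by apply/eqP; rewrite eq_le x0 sqnorm_ge0.
Qed.

Lemma sqnormN x : sqnorm (- x) = sqnorm x.
Proof. by rewrite /sqnorm dotNl dotNr opprK. Qed.

Lemma sqnormZ a x : sqnorm (a *: x) = sqmod a * sqnorm x.
Proof. by rewrite /sqnorm /sqmod dotZl dotZr dotxx; case: a => p q /=; ring. Qed.

Lemma sqnormD_orth x y : dot x y = 0 -> sqnorm (x + y) = sqnorm x + sqnorm y.
Proof.
move=> xy; rewrite /sqnorm dotDl !dotDr xy (dot_conj x y) xy conjc0.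
by rewrite !dotxx /= addr0 add0r.
Qed.

(** Parallelogram law with the nonnegative term [sqnorm (x - y)] dropped. *)
Lemma sqnormD_le x y : sqnorm (x + y) <= 2 * (sqnorm x + sqnorm y).
Proof.
have : sqnorm (x + y) + sqnorm (x - y) = 2 * (sqnorm x + sqnorm y).
  rewrite /sqnorm !dotDl !dotDr !dotNl !dotNr !dotxx (dot_conj x y).
  by case: (dot x y) => p q /=; ring.
by have := sqnorm_ge0 (x - y); lra.
Qed.

Lemma hnormE x : hnorm x = Num.sqrt (sqnorm x). Proof. by []. Qed.

Lemma sqnormE x : sqnorm x = hnorm x ^+ 2.
Proof. by rewrite hnormE sqr_sqrtr ?sqnorm_ge0. Qed.

Lemma hnorm_ge0 x : 0 <= hnorm x. Proof. exact: sqrtr_ge0. Qed.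

Lemma ler_hnorm x y : sqnorm x <= sqnorm y -> hnorm x <= hnorm y.
Proof. by move=> xy; rewrite !hnormE ler_wsqrtr. Qed.

Lemma hnorm_le x (M : R) : 0 <= M -> sqnorm x <= M ^+ 2 -> hnorm x <= M.
Proof. by move=> M0; rewrite sqnormE ler_pXn2r ?nnegrE ?hnorm_ge0. Qed.

Section Projection.
Context (P : {linear H -> H}) (Pproj : orthogonal_projection P).

(** Pythagoras: self-adjointness and idempotence make [P x] orthogonal to [x - P x]. *)
Lemma sqnorm_proj x : sqnorm x = sqnorm (P x) + sqnorm (x - P x).
Proof.
have [PP PA] := Pproj.
have orth : dot (P x) (x - P x) = 0 by rewrite PA linearB /= PP subrr dot0r.
by rewrite -sqnormD_orth// addrC subrK.
Qed.

Lemma sqnorm_proj_le x : sqnorm (P x) <= sqnorm x.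
Proof. by rewrite [leRHS]sqnorm_proj lerDl sqnorm_ge0. Qed.

Lemma sqnorm_coproj_le x : sqnorm (x - P x) <= sqnorm x.
Proof. by rewrite [leRHS]sqnorm_proj lerDr sqnorm_ge0. Qed.

End Projection.

Section AddProjection.
Context (P : {linear H -> H}) (y : H).

(** One Gram-Schmidt step without normalisation. It is meant for [P y = 0], when [y] is orthogonal
    to the range of [P]. *)
Definition add_proj x := P x + (dot x y / dot y y) *: y.

Lemma add_proj_linear : linear add_proj.
Proof.
move=> a u v; rewrite /add_proj linearP dot_linear mulrDl scalerDl scalerDr.
by rewrite scalerA mulrA addrACA.
Qed.

HB.instance Definition _ :=
  GRing.isLinear.Build R[i] H H *:%R add_proj add_proj_linear.

Lemma add_proj_orth : orthogonal_projection P -> P y = 0 -> y != 0 ->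
  orthogonal_projection add_proj.
Proof.
move=> [PP PA] Py0 y0.
have yy0 : dot y y != 0 by apply: contraNneq y0 => /dot_eq0 ->.
split => [x|x z] /=.
- rewrite /add_proj linearD linearZ /= Py0 scaler0 addr0 PP.
  by rewrite dotDl PA Py0 dot0r add0r dotZl mulfVK.
- rewrite /add_proj dotDl dotDr PA dotZl dotZr conjcM conjc_inv -!dot_conj.
  by rewrite [in RHS]mulrC [in LHS]mulrAC mulrA.
Qed.

End AddProjection.

Definition in_span (s : seq H) x :=
  exists c : nat -> R[i], x = \sum_(i < size s) c i *: s`_i.

(** Gram-Schmidt by induction on [s]: a new vector [v] contributes the line of its residue
    [v - P v], unless that residue is zero. *)
Lemma proj_span (s : seq H) : exists P : {linear H -> H},
  [/\ orthogonal_projection P, forall v, v \in s -> P v = v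
    & forall x, in_span s (P x)].
Proof.
elim: s => [|v s [P [Porth Ps sP]]].
  exists (\0 : {linear H -> H}); split => //.
  - by split => // x z; rewrite /= dot0l dot0r.
  - by move=> x; exists (fun=> 0); rewrite big_ord0.
have [PP PA] := Porth.
have Py0 : P (v - P v) = 0 by rewrite linearB /= PP subrr.
have [y0|y0] := eqVneq (v - P v) 0.
  exists P; split => // [w|x].
    rewrite inE => /orP[/eqP ->|/Ps//]; exact/esym/subr0_eq.
  have [c ->] := sP x; exists (fun i => if i is j.+1 then c j else 0).
  by rewrite big_ord_recl /= scale0r add0r.
have yy0 : dot (v - P v) (v - P v) != 0 by apply: contraNneq y0 => /dot_eq0 ->.
exists (add_proj P (v - P v)); split => [|w|x] /=.
- exact: add_proj_orth.
- rewrite inE /= /add_proj => /orP[/eqP ->|ws].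
    have -> : dot v (v - P v) = dot (v - P v) (v - P v).
      by rewrite [RHS]dotDl dotNl PA Py0 dot0r oppr0 addr0.
    by rewrite divff// scale1r addrC subrK.
  by rewrite -{2}(Ps w ws) PA Py0 dot0r mul0r scale0r addr0 Ps.
- rewrite /add_proj; set k := dot x _ / _; have [c Pvc] := sP v; have [d Pxd] := sP x.
  (* Regroup [P x + k (v - P v)] as [k v + (P x - k P v)], with [P x] and [P v] expanded over
     [s]. *)
  exists (fun i => if i is j.+1 then d j - k * c j else k).
  rewrite big_ord_recl /= scalerBr Pvc Pxd addrCA; congr (_ + _).
  rewrite scaler_sumr -sumrB; apply: eq_bigr => i _.
  by rewrite scalerBl scalerA.
Qed.

(** * Closure of the linear span of a sequence *)

Definition closed_span (e : nat -> H) x := forall eps : R, 0 < eps ->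
  exists (m : nat) (c : nat -> R[i]), sqnorm (x - \sum_(i < m) c i *: e i) <= eps.

Section ClosedSpan.
Context (e : nat -> H).

Lemma closed_span_lim x : (forall eps : R, 0 < eps ->
    exists2 y, closed_span e y & sqnorm (x - y) <= eps) -> closed_span e x.
Proof.
move=> xlim eps eps0.
(* Two errors of [eps / 4] add up to [eps] because of the factor 2 in [sqnormD_le]. *)
have eps40 : 0 < eps / 4 by rewrite divr_gt0.
have [y ey xy] := xlim _ eps40; have [m [c yc]] := ey _ eps40.
exists m, c; rewrite -[x](subrK y) -addrA.
by apply: le_trans (sqnormD_le _ _) _; lra.
Qed.

Lemma closed_span_gen n : closed_span e (e n).
Proof.
move=> eps eps0; exists n.+1, (fun i => (i == n)%:R).
rewrite big_ord_recr /= eqxx scale1r big1 ?add0r ?subrr ?sqnorm0 ?ltW// => i _.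
by rewrite ltn_eqF ?scale0r.
Qed.

Lemma closed_span0 : closed_span e 0.
Proof.
move=> eps eps0; exists 0, (fun=> 0).
by rewrite big_ord0 subr0 sqnorm0 ltW.
Qed.

Lemma closed_spanD x y : closed_span e x -> closed_span e y ->
  closed_span e (x + y).
Proof.
(* Padding with zero coefficients brings two combinations to a common length. *)
have widen m n (c : nat -> R[i]) : (m <= n)%N -> \sum_(i < m) c i *: e i =
    \sum_(i < n) (if (i < m)%N then c i else 0) *: e i.
  move=> mn; rewrite (big_ord_widen n (fun i => c i *: e i))// big_mkcond /=.
  by apply: eq_bigr => i _; case: ifP => // _; rewrite scale0r.
move=> ex ey eps eps0; have eps40 : 0 < eps / 4 by rewrite divr_gt0.
have [m [c xc]] := ex _ eps40; have [n [d yd]] := ey _ eps40.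
rewrite (widen _ _ _ (leq_maxl m n)) in xc.
rewrite (widen _ _ _ (leq_maxr m n)) in yd.
exists (maxn m n), (fun i => (if (i < m)%N then c i else 0) +
  (if (i < n)%N then d i else 0)).
under eq_bigr do rewrite scalerDl.
rewrite big_split /= opprD addrACA.
by apply: le_trans (sqnormD_le _ _) _; lra.
Qed.

Lemma closed_spanZ a x : closed_span e x -> closed_span e (a *: x).
Proof.
move=> ex eps eps0; set N := sqmod a.
have N0 : 0 <= N := sqmod_ge0 a.
(* Dividing by [N + 1] rather than [N] also covers [a = 0]. *)
have [|m [c xc]] := ex (eps / (N + 1)); first by rewrite divr_gt0// ltr_wpDl.
exists m, (fun i => a * c i); under eq_bigr do rewrite -scalerA.
rewrite -scaler_sumr -scalerBr sqnormZ -/N.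
apply: (@le_trans _ _ ((N + 1) * (eps / (N + 1)))).
  by apply: ler_pM => //; [exact: sqnorm_ge0|rewrite lerDl].
by rewrite mulrC divfK// gt_eqF// ltr_wpDl.
Qed.

Lemma closed_spanB x y : closed_span e x -> closed_span e y ->
  closed_span e (x - y).
Proof.
by move=> ex ey; rewrite -[- y]scaleN1r; apply/closed_spanD/closed_spanZ.
Qed.

End ClosedSpan.

(** The range of [P n] is invariant under a nilpotent [A n] within [1 / (n + 1)] of [T], and
    contains [e 0], ..., [e n]. Invariance gives the commutation estimate; totality of [e] gives
    strong convergence. *)
Theorem quasitriangular_lim_nilpotent (e : nat -> H) (T : {linear H -> H}) :
    (forall x, closed_span e x) -> bounded_operator T ->
    (forall eps : R, 0 < eps -> exists (A : {linear H -> H}) (N : nat),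
       (forall x, iter N A x = 0) /\
       (forall x, hnorm (T x - A x) <= eps * hnorm x)) ->
  quasitriangular T.
Proof.
move=> etot Tbd Tnil; split => //.
have inv_gt0 n : 0 < n.+1%:R^-1 :> R by rewrite invr_gt0.
have /choice[A /choice[N AN]] n := Tnil _ (inv_gt0 n).
(* Each stage adjoins [e m] and all iterates under [A m] up to exponent [N m]. The exponent 0 keeps
   the earlier vectors, so the spans increase. *)
pose s := fix s n := if n is m.+1 then
  [seq iter j (A m) v | v <- e m :: s m, j <- iota 0 (N m).+1] else [::].
have /choice[P Pproj] n := proj_span (s n.+1).
have Porth n : orthogonal_projection (P n) by have [] := Pproj n.
have Pfix n v : v \in s n.+1 -> P n v = v by have [_ + _] := Pproj n; apply.
have Pspan n x : in_span (s n.+1) (P n x) by have [_ _] := Pproj n; apply.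
have s_mono m v : v \in s m -> v \in s m.+1.
  by move=> vs; apply/allpairsP; exists (v, 0); rewrite inE vs orbT.
have s_gen m n : (m < n)%N -> e m \in s n.
  elim: n => // n IH; rewrite ltnS leq_eqVlt => /orP[/eqP ->|/IH/s_mono//].
  by apply/allpairsP; exists (e n, 0); rewrite inE eqxx.
(* [A n] sends an iterate of exponent [j < N n] to the next one in the list, and the last one to
   zero. *)
have sA n v : v \in s n.+1 -> P n (A n v) = A n v.
  move=> /allpairsP[[w j] [ws]]; rewrite mem_iota /= add0n ltnS => jN ->.
  have [jlt|] := ltnP j (N n).
    apply: Pfix; rewrite -iterS.
    by apply/allpairsP; exists (w, j.+1); split; rewrite ?mem_iota.
  move=> Nj; have -> : j = N n by apply/eqP; rewrite eqn_leq jN.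
  by rewrite (AN n).1 !linear0.
have PAP n x : P n (A n (P n x)) = A n (P n x).
  have [c ->] := Pspan n x; rewrite !linear_sum; apply: eq_bigr => i _.
  by rewrite !linearZ /= sA// mem_nth.
exists P; split.
- move=> n; split => //; exists (size (s n.+1)), (fun i => (s n.+1)`_i) => x.
  by have [c ->] := Pspan n x; exists c.
- move=> n _ [x _ <-]; exists (P n x) => //.
  have [c ->] := Pspan n x; rewrite !linear_sum; apply: eq_bigr => i _.
  by rewrite linearZ /= Pfix// s_mono// mem_nth.
- move=> x; apply/cvgrPdist_le => eps eps0.
  (* [closed_span] bounds a squared norm, hence the tolerance [eps ^+ 2]. *)
  have [m [c xc]] := etot x (eps ^+ 2) (exprn_gt0 _ eps0).
  exists m => // n /= mn; rewrite sub0r normrN ger0_norm ?hnorm_ge0//.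
  apply: hnorm_le; first exact: ltW.
  apply: le_trans xc; set y := \sum_(i < m) _.
  have Py : P n y = y.
    rewrite linear_sum; apply: eq_bigr => i _.
    by rewrite linearZ /= Pfix// s_gen// ltnS (leq_trans _ mn)// ltnW.
  (* As [P n] fixes [y], the error at [x] is, up to sign, the complementary projection of
     [x - y]. *)
  rewrite -sqnormN; have -> : - (P n x - x) = (x - y) - P n (x - y).
    by rewrite (linearB (P n)) /= Py !opprB subrKA.
  exact: sqnorm_coproj_le.
- apply: (@squeeze_cvge _ _ _ _ (fun=> 0%E) _ (fun n => n.+1%:R^-1%:E)).
  + apply: nearW => n; apply/andP; split.
      apply: ereal_sup_ubound; exists 0; first by rewrite /= hnormE sqnorm0 sqrtr0.
      by rewrite !linear0 addr0 hnormE sqnorm0 sqrtr0.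
    apply: ub_ereal_sup => _ [x /= x1 <-]; rewrite lee_fin.
    set y := P n x.
    (* [A n y] is fixed by [P n], so it can be subtracted inside; both [P n] and its complement are
       contractions, which leaves the bound on [T - A n]. *)
    have -> : T y - P n (T y) = (T y - A n y) - P n (T y - A n y).
      by rewrite (linearB (P n)) /= /y PAP opprB subrKA.
    apply: le_trans (ler_hnorm (sqnorm_coproj_le (Porth n) _)) _.
    apply: le_trans ((AN n).2 _) _; rewrite ler_piMr ?(ltW (inv_gt0 n))//.
    exact: le_trans (ler_hnorm (sqnorm_proj_le (Porth n) _)) x1.
  + exact: cvg_cst.
  + by apply: cvg_EFin; [exact: nearW|exact: cvg_harmonic].
Qed.

End InnerProduct.

(** * Weighted rotations *)

Section Rotation.
Context (R : realType).
Local Notation mu := (@lebesgue_measure R).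
Local Notation I01 := `[0 : R, 1[%classic.
Implicit Types (f : R -> R[i]) (phi psi g : R -> R) (s t b : R).

Lemma frac_in t : I01 (frac t).
Proof. by rewrite /= in_itv/= frac_itv. Qed.

Lemma frac_id t : I01 t -> frac t = t.
Proof. by rewrite /= in_itv/= -[t]addr0 => /andP[t0 t1]; rewrite frac_lo. Qed.

Lemma fracfracD s t : frac (frac s + t) = frac (s + t).
Proof. by rewrite addrC -fracDfrac addrC. Qed.

(** The rotation by [a] exchanges two intervals: it translates [0, 1 - a[ onto [a, 1[ and [1 - a, 1[
    onto [0, a[. *)
Lemma ge0_integral_rot b g : measurable_fun I01 g -> (forall t, 0 <= g t) ->
  (\int[mu]_(t in I01) (g (frac (t + b)))%:E = \int[mu]_(t in I01) (g t)%:E)%E.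
Proof.
move=> mg g0; set a := frac b.
have /andP[a0 a1] : 0 <= a < 1 := frac_itv b.
have sub (x y : R) : 0 <= x -> y <= 1 ->
    measurable_fun (`[x, y[%classic : set (measurableTypeR R)) (EFin \o g).
  move=> x0 y1; apply/measurable_EFinP; apply: measurable_funS mg => // t /=.
  by rewrite !in_itv/= => /andP[? ?]; apply/andP; split; lra.
have h0 (t : measurableTypeR R) : (0 <= (EFin \o g) t)%E by rewrite lee_fin.
(* The cut [c = 1] must be allowed, since [a] may be 0. *)
have split_int (c : R) (h : R -> R) : 0 <= c <= 1 ->
    measurable_fun I01 h -> (forall t, 0 <= h t) ->
    (\int[mu]_(t in I01) (h t)%:E = \int[mu]_(t in `[0%R, c[) (h t)%:E +
       \int[mu]_(t in `[c, 1%R[) (h t)%:E)%E.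
  move=> /andP[c0 c1] mh hge0.
  have IE : I01 = `[0, c[%classic `|` `[c, 1[%classic.
    apply/seteqP; split => t /=; rewrite !in_itv/=.
      by move=> /andP[-> ->]; rewrite andbT /=; case: (ltP t c) => _; [left|right].
    by move=> [/andP[? ?]|/andP[? ?]]; apply/andP; split; lra.
  rewrite [in LHS]IE ge0_integral_setU//=.
  - by rewrite -IE; exact/measurable_EFinP.
  - by move=> t _; rewrite lee_fin.
  - rewrite disj_set2E; apply/eqP/seteqP; split => t //=.
    rewrite !in_itv/= => -[/andP[_ h1] /andP[h2 _]].
    by move: (lt_le_trans h1 h2); rewrite ltxx.
rewrite (split_int (1 - a))//; [|by apply/andP; split; lra|exact: measurable_rot].
rewrite [RHS](split_int a)//; last by apply/andP; split; lra.
rewrite [RHS]addeC; congr (_ + _)%E.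
- have := ge0_integral_shiftr a (sub a 1 a0 (lexx 1)) h0.
  rewrite subrr => <-; apply: eq_integral => t /set_mem /=.
  by rewrite in_itv/= => /andP[t0 t1]; rewrite fracDfrac -/a frac_lo//; lra.
- have := ge0_integral_shiftr (a - 1) (sub 0 a (lexx 0) (ltW a1)) h0.
  have -> : 0 - (a - 1) = 1 - a by ring.
  have -> : a - (a - 1) = 1 by ring.
  move=> <-; apply: eq_integral => t /set_mem /=.
  by rewrite in_itv/= => /andP[t0 t1]; rewrite fracDfrac -/a frac_hi//; lra.
Qed.

Lemma Rintegral_rot b g : mu.-integrable I01 (EFin \o g) ->
  \int[mu]_(t in I01) g (frac (t + b)) = \int[mu]_(t in I01) g t.
Proof.
move=> /integrableP[/measurable_EFinP mg _]; rewrite /Rintegral; congr fine.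
rewrite integralE [RHS]integralE !funerpos !funerneg; congr (_ - _)%E.
- apply: (ge0_integral_rot b (g := (g^\+)%R)); first exact: measurable_funrpos.
  exact: funrpos_ge0.
- apply: (ge0_integral_rot b (g := (g^\-)%R)); first exact: measurable_funrneg.
  exact: funrneg_ge0.
Qed.

Lemma eq_integralC f f' : (forall t, I01 t -> f t = f' t) ->
  integralC f = integralC f'.
Proof.
move=> ff'; rewrite /integralC.
by congr (_ +i* _)%C; apply: eq_Rintegral => t /set_mem /ff' ->.
Qed.

Lemma integralC_rot b f : integrableC f ->
  integralC (fun t => f (frac (t + b))) = integralC f.
Proof.
by move=> [fr fi]; rewrite /integralC (Rintegral_rot b fr) (Rintegral_rot b fi).
Qed.

Lemma sqnorm_class (u : L2fun R) :
  sqnorm (L2class u) = \int[mu]_(t in I01) sqmod (u t).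
Proof. by rewrite /sqnorm [dot _ _]L2dotE L2dotxx. Qed.

(** Integrate the pointwise bound and undo the rotation. With [c = 1] this yields contractivity and
    independence of representatives; with [c = eps ^+ 2], the distance between two weighted
    rotations. *)
Lemma sqnorm_class_rot_le b (c : R) (u v : L2fun R) : 0 <= c ->
  (forall t, I01 t -> sqmod (v t) <= c * sqmod (u (frac (t + b)))) ->
  sqnorm (L2class v) <= c * sqnorm (L2class u).
Proof.
move=> c0 uv; rewrite !sqnorm_class.
have iu := sqint_comp (L2funP u).
rewrite -(@Rintegral_rot b (fun t => sqmod (u t)))//.
have iur : mu.-integrable I01 (fun t => (sqmod (u (frac (t + b))))%:E).
  have mu2 : measurable_fun I01 (fun t => sqmod (u t)).
    by have /integrableP[/measurable_EFinP] := iu.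
  apply/integrableP; split.
    by apply/measurable_EFinP; exact: (measurable_rot b mu2).
  under eq_integral do rewrite gee0_abs ?lee_fin ?sqmod_ge0//.
  apply: (integral_rot_lty b mu2) => [t|]; first exact: sqmod_ge0.
  by have [] := L2funP u.
rewrite -RintegralZl//; apply: le_Rintegral => //.
- exact: sqint_comp (L2funP v).
by have := integrableZl (@measurable_I01 R) c iur.
Qed.

(** * Weighted rotations: contractivity, nilpotency, adjoint *)

Definition weight phi := measurable_fun I01 phi /\
  forall t, I01 t -> `|phi t| <= 1.

Definition wrot_fun phi b f : R -> R[i] :=
  fun t => ((phi t)%:C)%C * f (frac (t + b)).

Lemma sqint_wrot phi b f : weight phi -> square_integrable f ->
  square_integrable (wrot_fun phi b f).
Proof.
move=> [mphi phi1] [mr mi foo].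
have m1 : measurable_fun I01 (fun t => complex.Re (wrot_fun phi b f t)).
  rewrite (_ : (fun _ => _) = (fun t => phi t * complex.Re (f (frac (t + b))))).
    apply: measurable_funM => //.
    exact: (measurable_rot b (g := fun t => complex.Re (f t))).
  by apply/funext => t; rewrite /wrot_fun; case: (f _) => ? ? /=; ring.
have m2 : measurable_fun I01 (fun t => complex.Im (wrot_fun phi b f t)).
  rewrite (_ : (fun _ => _) = (fun t => phi t * complex.Im (f (frac (t + b))))).
    apply: measurable_funM => //.
    exact: (measurable_rot b (g := fun t => complex.Im (f t))).
  by apply/funext => t; rewrite /wrot_fun; case: (f _) => ? ? /=; ring.
have mS : measurable_fun I01 (fun t => sqmod (f t)).
  by apply: measurable_funD; exact: measurable_funX.
split => //.
have := integral_rot_lty b mS (fun t => sqmod_ge0 (f t)) foo.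
apply: le_lt_trans; apply: ge0_le_integral => //.
- by move=> t _; rewrite lee_fin sqmod_ge0.
- by apply/measurable_EFinP/measurable_funD; exact: measurable_funX.
- by apply/measurable_EFinP; exact: (measurable_rot b mS).
move=> t tI; rewrite lee_fin -/(sqmod _) sqmodM sqmod_real ler_piMl ?sqmod_ge0//.
by rewrite -real_normK ?num_real// expr_le1// phi1.
Qed.

Lemma L2classB (u v : L2fun R) : L2class (u - v) = L2class u - L2class v.
Proof. by apply: (addIr (L2class v)); rewrite -L2classD !subrK. Qed.

Section WeightedRotation.
Context (phi : R -> R) (phiw : weight phi) (b : R).

Definition wrot (x : L2 R) : L2 R :=
  L2class (toL2fun (sqint_wrot b phiw (L2funP (repr x)))).

Lemma weight_sqr_le1 t : I01 t -> phi t ^+ 2 <= 1.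
Proof.
by move=> tI; rewrite -real_normK ?num_real// expr_le1//; exact: phiw.2.
Qed.

(** The two sides differ by the class of the weighted rotation of [v - u], whose norm is at most
    that of the class of [v - u], which is zero. *)
Lemma wrot_class u :
  wrot (L2class u) = L2class (toL2fun (sqint_wrot b phiw (L2funP u))).
Proof.
set v := repr (L2class u); apply: subr0_eq; rewrite -L2classB; apply: sqnorm_eq0.
apply: (@le_trans _ _ (1 * sqnorm (L2class (v - u)))).
  apply: (@sqnorm_class_rot_le b) => // t tI.
  rewrite [X in sqmod X](_ : _ = ((phi t)%:C)%C * (v - u) (frac (t + b))).
    by rewrite sqmodM sqmod_real ler_wpM2r ?sqmod_ge0// weight_sqr_le1.
  by rewrite mulrBr.
by rewrite L2classB L2class_repr subrr sqnorm0 mulr0.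
Qed.

Lemma wrot_linear : linear wrot.
Proof.
move=> a x y; rewrite -[x]L2class_repr -[y]L2class_repr.
rewrite -L2classZ -L2classD !wrot_class -L2classZ -L2classD.
by apply/L2classP/aeW => t _; rewrite /= /wrot_fun /= mulrDr mulrCA.
Qed.
HB.instance Definition _ :=
  GRing.isLinear.Build R[i] (L2 R) (L2 R) *:%R wrot wrot_linear.

Lemma hnorm_wrot_le x : hnorm (wrot x) <= hnorm x.
Proof.
rewrite -[x]L2class_repr wrot_class; apply: ler_hnorm; rewrite -[leRHS]mul1r.
apply: (@sqnorm_class_rot_le b) => // t tI.
by rewrite sqmodM sqmod_real ler_wpM2r ?sqmod_ge0// weight_sqr_le1.
Qed.

(** The N-th power multiplies by the product of the weights at the first N orbit points, and by
    hypothesis one factor is zero. *)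
Lemma wrot_nilpotent N : (forall t, I01 t ->
    exists2 j, (j < N)%N & phi (frac (t + j%:R * b)) = 0) ->
  forall x, iter N wrot x = 0.
Proof.
move=> hit x; rewrite -[x]L2class_repr.
(* The hitting condition moves inside, pointwise in [t], so that induction on [N] can go through
   smaller [N]. *)
suff [v -> v0] : exists2 v, iter N wrot (L2class (repr x)) = L2class v &
    forall t, I01 t ->
      (exists2 j, (j < N)%N & phi (frac (t + j%:R * b)) = 0) -> v t = 0.
  by rewrite -(L2class0 R); apply/L2classP/aeW => t tI; rewrite v0//; exact: hit.
elim: N {hit} => [|N [v vN v0]]; first by exists (repr x) => // t _ [].
exists (toL2fun (sqint_wrot b phiw (L2funP v))).
  by rewrite iterS vN wrot_class.
(* Either the weight vanishes at [t] itself, or the orbit of [frac (t + b)] meets a zero one step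
   earlier. *)
move=> t tI [[|j] jN phi0]; rewrite /= /wrot_fun.
  by move: phi0; rewrite mul0r addr0 frac_id// => ->; rewrite mul0r.
rewrite v0 ?mulr0//; first exact: frac_in.
exists j => //; rewrite fracfracD -addrA -{1}[b]mul1r -mulrDl nat1r.
exact: phi0.
Qed.

End WeightedRotation.

Lemma weight_rot phi b : weight phi -> weight (fun t => phi (frac (t + b))).
Proof.
move=> [mphi phi1]; split; first exact: measurable_rot.
by move=> t _; apply/phi1/frac_in.
Qed.

(** Rotating the right-hand integrand by [b] carries its weight back to [phi t], which is real and
    so passes through the conjugation. *)
Lemma wrot_adjoint phi b (phiw : weight phi)
    (phiw' : weight (fun t => phi (frac (t - b)))) :
  adjoint_of (wrot phiw b) (wrot phiw' (- b)).
Proof.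
move=> x y; rewrite -[x]L2class_repr -[y]L2class_repr !wrot_class.
rewrite ![dot _ _]L2dotE -[RHS](integralC_rot b); last first.
  by apply: sqint_mulJ; exact: L2funP.
apply: eq_integralC => t tI; rewrite /= /wrot_fun fracfracD addrK (frac_id tI).
rewrite rmorphM [RHS]mulrA; congr (_ * _); rewrite mulrC; congr (_ * _).
exact/esym/conjc_real.
Qed.

End Rotation.

(** * Orbits of an irrational rotation *)

Section IrrationalRotation.
Context (R : realType).
Implicit Types (b t eps : R).
Local Notation I01 := `[0 : R, 1[%classic.

Lemma fracDint t (m : int) : frac (t + m%:~R) = frac t.
Proof.
by rewrite /frac (floorDrz t (intr_int _ m)) intrKfloor intrD opprD addrACA subrr addr0.
Qed.

Lemma fracE t : exists m : int, t = frac t + m%:~R.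
Proof. by exists (Num.floor t); rewrite subrK. Qed.

(** Dirichlet's pigeonhole argument: two of [M + 1] multiples of [b] fall modulo 1 into the same of
    [M] boxes of length [1 / M]. *)
Lemma irrational_close_return b eps : irrational b -> 0 < eps ->
  exists (d : nat) (m : int) (delta : R),
    [/\ d%:R * b = delta + m%:~R, delta != 0, `|delta| < eps & `|delta| < 1].
Proof.
move=> birr eps0; pose M := (Num.truncn eps^-1).+1.
have M0 : 0 < M%:R :> R by [].
have MeV : M%:R^-1 < eps.
  rewrite invf_plt ?posrE//.
  have e0 : 0 <= eps^-1 by rewrite invr_ge0 ltW.
  by have /andP[] := truncn_itv e0.
pose f (j : 'I_M.+1) : 'I_M := inord (Num.truncn (M%:R * frac (j%:R * b))).
have fE j : (f j)%:R <= M%:R * frac (j%:R * b) < (f j).+1%:R.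
  have /andP[f0 f1] := frac_itv (j%:R * b).
  have Mf0 : 0 <= M%:R * frac (j%:R * b) by rewrite mulr_ge0.
  rewrite inordK; first exact: truncn_itv.
  by rewrite truncn_lt_nat// gtr_pMr.
have /injectivePn[i [j ij fij]] : ~~ injectiveb f.
  by apply/negP => /injectiveP /leq_card; rewrite !card_ord ltnn.
wlog lt_ij : i j ij fij / (i < j)%N.
  move=> W; have : (i : nat) != j by [].
  by rewrite neq_ltn => /orP[|] ?; [exact: (W i j)|apply: (W j i); rewrite 1?eq_sym].
pose delta := frac (j%:R * b) - frac (i%:R * b).
have [mi Ei] := fracE (i%:R * b); have [mj Ej] := fracE (j%:R * b).
have dE : (j - i)%N%:R * b = delta + (mj - mi)%:~R.
  by rewrite natrB ?(ltnW lt_ij)// mulrBl Ei Ej /delta intrB; ring.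
have dM : `|delta| < M%:R^-1.
  have /andP[a1 a2] := fE i; have /andP[c1 c2] := fE j; rewrite fij in a1 a2.
  rewrite -[ltRHS]mul1r ltr_pdivlMr// -[X in `|_| * X](ger0_norm (ltW M0)) -normrM.
  rewrite mulrC mulrBr ltr_norml.
  by rewrite -natr1 in a2 c2; apply/andP; split; lra.
exists (j - i)%N, (mj - mi), delta; split => //.
(* A zero [delta] would make [(j - i) b] an integer, hence [b] rational. *)
- apply: contra_notN birr => /eqP d0; apply/rationalP.
  exists (mj - mi), (j - i)%N; rewrite d0 add0r in dE.
  by rewrite -dE mulrC mulKf// pnatr_eq0 -lt0n subn_gt0.
- exact: lt_trans MeV.
- by apply: lt_le_trans dM _; rewrite invf_ple ?posrE ?invr1 ?ler1n.
Qed.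

(** Every [d] steps move the orbit by [delta] modulo 1. As [|delta| < eps], these moves cannot jump
    over [0, eps[, and about [1 / |delta|] of them go once around from any start. *)
Lemma irrational_rot_hit b eps : irrational b -> 0 < eps ->
  exists N : nat, forall t, exists2 j, (j < N)%N & frac (t + j%:R * b) < eps.
Proof.
move=> birr eps0.
have [d [m [delta [dE delta0 deltae delta1]]]] := irrational_close_return birr eps0.
have nd : 0 < `|delta| by rewrite normr_gt0.
have nd_neq0 : `|delta| != 0 by rewrite gt_eqF.
have jE (t : R) (k : nat) : frac (t + (k * d)%:R * b) = frac (frac t + k%:R * delta).
  rewrite fracfracD natrM -mulrA dE mulrDr addrA -[k%:R * m%:~R]/((k : int)%:~R * m%:~R).
  by rewrite -intrM fracDint.
pose K := (Num.truncn (`|delta|^-1)).+1.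
exists (K * d).+1 => t; have /andP[t0 t1] := frac_itv t.
suff [k kK kt] : exists2 k, (k <= K)%N & frac (frac t + k%:R * delta) < eps.
  by exists (k * d)%N; rewrite ?jE// ltnS leq_mul.
have Kbound x : 0 <= x <= 1 -> (Num.truncn (x / `|delta|) < K)%N.
  move=> /andP[x0 x1]; rewrite ltnS le_truncn// ler_piMl// invr_ge0 ltW//.
have [delta_lt0|] := ltP delta 0.
(* Moving left: [k] is the last count before passing 0, so the orbit lands in [0, |delta|[. *)
- pose k := Num.truncn (frac t / `|delta|).
  have /andP[k1 k2] : k%:R <= frac t / `|delta| < k.+1%:R.
    by apply: truncn_itv; rewrite divr_ge0.
  exists k; first by rewrite ltnW// Kbound// t0 ltW.
  rewrite ltr0_norm// in nd nd_neq0 deltae delta1 k1 k2.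
  rewrite ler_pdivlMr// in k1; rewrite ltr_pdivrMr// -natr1 in k2.
  by rewrite frac_lo; lra.
- rewrite le_eqVlt eq_sym (negbTE delta0) /= => delta_gt0.
  (* Moving right: the move [k.+1] is the first to pass 1 and lands in ]0, delta] after wrapping;
     [delta < 1] keeps the sum below 2. *)
  pose k := Num.truncn ((1 - frac t) / `|delta|).
  have /andP[k1 k2] : k%:R <= (1 - frac t) / `|delta| < k.+1%:R.
    by apply: truncn_itv; rewrite divr_ge0// subr_ge0 ltW.
  exists k.+1; first by rewrite Kbound//; apply/andP; split; lra.
  rewrite gtr0_norm// in nd nd_neq0 deltae delta1 k1 k2.
  rewrite ler_pdivlMr// in k1; rewrite ltr_pdivrMr// -natr1 in k2.
  by rewrite -natr1 frac_hi; lra.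
Qed.

(** * The Bishop weight and its truncation near 0 *)

Lemma weight_id : weight (fun t : R => t).
Proof.
split; first exact: measurable_id.
by move=> t; rewrite /= in_itv/= => /andP[t0 t1]; rewrite ger0_norm// ltW.
Qed.

Definition cutoff eps t := t * \1_(`[eps, +oo[ : set (measurableTypeR R)) t.

Lemma weight_cutoff eps : weight (cutoff eps).
Proof.
split; first by apply: measurable_funM => //; exact: measurable_indic.
move=> t tI; rewrite /cutoff normrM -[leRHS]mulr1.
apply: ler_pM => //; first exact: weight_id.2.
by rewrite indicE; case: (_ \in _); rewrite ?normr1 ?normr0.
Qed.

Lemma cutoff_close eps t : 0 < eps -> I01 t -> `|t - cutoff eps t| <= eps.
Proof.
move=> eps0; rewrite /= in_itv/= => /andP[t0 t1]; rewrite /cutoff indicE.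
have [|] := leP eps t => te.
  by rewrite mem_set ?mulr1 ?subrr ?normr0 ?ltW//= in_itv/= te.
rewrite memNset; first by rewrite mulr0 subr0 (ger0_norm t0) ltW.
by rewrite /= in_itv/= andbT leNgt te.
Qed.

Lemma cutoff_eq0 eps t : t < eps -> cutoff eps t = 0.
Proof.
move=> te; rewrite /cutoff indicE memNset ?mulr0//.
by rewrite /= in_itv/= andbT leNgt te.
Qed.

End IrrationalRotation.

(** * Density of step functions *)

Section Density.
Context (R : realType).
Local Notation mu := (@lebesgue_measure R).
Local Notation I01 := `[0 : R, 1[%classic.
Implicit Types (g h : R -> R) (s t : R) (A B : set (measurableTypeR R)).

Lemma sqint_real_le g (G : R -> R) : measurable_fun I01 g ->
  mu.-integrable I01 (EFin \o G) -> (forall t, I01 t -> g t ^+ 2 <= G t) ->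
  square_integrable (fun t => ((g t)%:C)%C).
Proof.
move=> mg /integrableP[mG Goo] gG; split => //=.
apply: le_lt_trans Goo; apply: ge0_le_integral => //.
- by move=> t _; rewrite lee_fin addr_ge0 ?sqr_ge0.
- by apply/measurable_EFinP/measurable_funD => //; exact: measurable_funX.
- exact: measurableT_comp.
- move=> t tI; rewrite lee_fin expr0n addr0.
  exact: le_trans (gG t tI) (ler_norm _).
Qed.

Lemma integrable_cst_I01 (c : R) : mu.-integrable I01 (EFin \o cst c).
Proof.
apply/integrableP; split; first exact/measurable_EFinP.
rewrite [X in (X < _)%E](_ : _ = `|c|%:E * mu I01)%E; last by rewrite -integral_cst.
by rewrite lebesgue_measure_itv/= lte_fin ltr01 sube0 mule1 ltry.
Qed.

Lemma sqint_indic A : measurable A ->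
  square_integrable (fun t => ((\1_A t : R)%:C)%C).
Proof.
move=> mA; apply: (sqint_real_le (G := cst 1)).
- exact: measurable_indic.
- exact: integrable_cst_I01.
- by move=> t _; rewrite indicE; case: (_ \in _); rewrite ?expr1n ?expr0n.
Qed.

Definition indic_class A (mA : measurable A) := L2class (toL2fun (sqint_indic mA)).

Lemma indic_classE A B (mA : measurable A) (mB : measurable B) :
  (forall t, I01 t -> A t <-> B t) -> indic_class mA = indic_class mB.
Proof.
move=> AB; apply/L2classP/aeW => t tI /=; congr (_%:C)%C; rewrite !indicE.
congr (_ : bool)%:R; apply/idP/idP => /set_mem /(AB t tI) ?; exact/mem_set.
Qed.

Lemma indic_classU A B (mA : measurable A) (mB : measurable B)
    (mAB : measurable (A `|` B)) : A `&` B = set0 ->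
  indic_class mAB = indic_class mA + indic_class mB.
Proof.
move=> AB0; rewrite -L2classD; apply/L2classP/aeW => t tI /=.
rewrite [RHS](_ : _ = ((\1_A t + \1_B t)%:C)%C); last by rewrite rmorphD.
congr (_%:C)%C; rewrite !indicE in_setU.
have [tA|tA] := boolP (t \in A); have [tB|tB] := boolP (t \in B);
  rewrite ?addr0 ?add0r//.
have : (A `&` B) t by split; exact: set_mem.
by rewrite AB0.
Qed.

(** * From rational rays to all of L^2 *)

Section Closure.
Context (e : nat -> L2 R).

(** Dominated convergence for the squared errors gives convergence in norm, and closed spans contain
    their limits. *)
Lemma closed_span_dominated (f_ : nat -> L2fun R) (f : L2fun R) (g : R -> R) :
  mu.-integrable I01 (EFin \o g) ->
  (forall n t, I01 t -> sqmod (f t - f_ n t) <= g t) ->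
  (forall t, I01 t -> sqmod (f t - f_ n t) @[n --> \oo] --> (0 : R)) ->
  (forall n, closed_span e (L2class (f_ n))) -> closed_span e (L2class f).
Proof.
move=> ig fg f0 ef; apply: closed_span_lim => eps eps0.
have mf n : measurable_fun I01 (fun t => (sqmod (f t - f_ n t))%:E).
  by have /integrableP[] := sqint_comp (L2funP (f - f_ n)).
have [] := @dominated_convergence _ _ _ mu _ (@measurable_I01 R)
  (fun n t => (sqmod (f t - f_ n t))%:E) (cst 0%E) (EFin \o g) mf.
- exact: measurable_cst.
- by apply: aeW => t tI; apply: cvg_EFin; [exact: nearW|exact: f0].
- exact: ig.
- apply: aeW => t n tI; rewrite gee0_abs ?lee_fin ?sqmod_ge0//; exact: fg.
move=> _ _; rewrite integral0 => /fine_cvgP[_ /cvgrPdist_le /(_ _ eps0)].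
move=> [n _ /(_ n (leqnn n))] /=; rewrite sub0r normrN => H.
exists (L2class (f_ n)) => //; rewrite -L2classB sqnorm_class.
exact: le_trans (ler_norm _) H.
Qed.

Lemma closed_span_real_dominated (g_ : nat -> R -> R) (g G : R -> R)
    (sg_ : forall n, square_integrable (fun t => ((g_ n t)%:C)%C))
    (sg : square_integrable (fun t => ((g t)%:C)%C)) :
  mu.-integrable I01 (EFin \o G) ->
  (forall n t, I01 t -> (g t - g_ n t) ^+ 2 <= G t) ->
  (forall t, I01 t -> g_ n t @[n --> \oo] --> g t) ->
  (forall n, closed_span e (L2class (toL2fun (sg_ n)))) ->
  closed_span e (L2class (toL2fun sg)).
Proof.
move=> iG gG gcvg; apply: (closed_span_dominated (g := G)) => //.
  by move=> n t tI; rewrite sqmod_realB; exact: gG.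
move=> t tI; under eq_fun do rewrite sqmod_realB.
have /cvgB/(_ (gcvg t tI)) : (g t @[n --> \oo] --> g t) by exact: cvg_cst.
by rewrite subrr => H; have := cvgM H H; rewrite mulr0; apply.
Qed.

Lemma closed_span_indic_lim (A_ : nat -> set (measurableTypeR R)) A
    (mA_ : forall n, measurable (A_ n)) (mA : measurable A) :
  (forall t, I01 t -> A t -> \forall n \near \oo, A_ n t) ->
  (forall n t, A_ n t -> A t) ->
  (forall n, closed_span e (indic_class (mA_ n))) ->
  closed_span e (indic_class mA).
Proof.
move=> AA_ A_A; apply: (closed_span_real_dominated (G := cst 1)).
- exact: integrable_cst_I01.
- move=> n t _; rewrite !indicE.
  by case: (_ \in _); case: (_ \in _); rewrite /= ?subrr ?subr0 ?sub0r ?sqrrN ?expr1n ?expr0n.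
- move=> t tI; apply: cvg_near_cst; have [tA|tA] := pselect (A t).
    by apply: filterS (AA_ t tI tA) => n tn; rewrite !indicE !mem_set.
  apply: nearW => n; rewrite !indicE !memNset//; exact: contra_not (@A_A n t) _.
Qed.

Context (e_ray : forall q : rat, closed_span e
  (indic_class (measurable_itv `]-oo, (ratr q : R)[))).

(** Dynkin's pi-lambda theorem: open left rays are stable under intersection and generate the Borel
    sets, while linearity and limits handle complements and disjoint unions. *)
Lemma closed_span_indic A (mA : measurable A) : closed_span e (indic_class mA).
Proof.
pose P A := forall mA : measurable A, closed_span e (indic_class mA).
suff : P A by [].
have {mA} mA : (@RGenInftyO.G R).-sigma.-measurable A.
  by rewrite -RGenInftyO.measurableE.
have PE B C : measurable C -> P C -> (forall t, I01 t -> B t <-> C t) -> P B.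
  by move=> mC PC BC mB; rewrite (indic_classE mB mC).
have Pray x : P `]-oo, x[%classic.
  move=> mx.
  (* A real endpoint is approached from the left by rational ones, so the rays fill up the given
     ray. *)
  have qx n : exists q : rat, x - n.+1%:R^-1 < ratr q < x.
    have /rat_in_itvoo[q] : x - n.+1%:R^-1 < x by rewrite ltrBlDr ltrDl invr_gt0.
    by rewrite in_itv; exists q.
  have /choice[q xq] := qx.
  apply: (closed_span_indic_lim
    (mA_ := fun n => measurable_itv `]-oo, (ratr (q n) : R)[)) => //.
  - move=> t _ /=; rewrite in_itv/= => tx.
    have xt0 : 0 < x - t by rewrite subr_gt0.
    have /cvgrPdist_lt/(_ _ xt0) := @cvg_harmonic R.
    apply: filterS => n /=; rewrite sub0r normrN ger0_norm//.
    rewrite in_itv/= => nxt; have /andP[qn _] := xq n.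
    by apply: lt_trans qn; rewrite ltrBrDr -ltrBrDl.
  - move=> n t /=; rewrite !in_itv/= => /lt_trans; apply.
    by have /andP[] := xq n.
have PT : P setT.
  apply: (PE _ `]-oo, 1[%classic) => // t /=; rewrite !in_itv/= => /andP[_ t1].
  by rewrite t1.
have PU B C : measurable B -> measurable C -> B `&` C = set0 ->
    P B -> P C -> P (B `|` C).
  move=> mB mC BC0 PB PC mBC; rewrite (indic_classU mB mC)//.
  exact: closed_spanD.
apply: (@dynkin_induction _ _ (@RGenInftyO.G R) P) mA => //.
- exact: RGenInftyO.measurableE.
- move=> _ _ [x ->] [y ->]; exists (Num.min x y).
  by apply/seteqP; split => t /=; rewrite !in_itv/= lt_min => /andP.
- by move=> _ [x ->].
- move=> B mB PB mCB.
  have mT : measurable (~` B `|` B) by exact: measurableU.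
  have BB : ~` B `&` B = set0 by rewrite setIC setICr.
  have -> : indic_class mCB = indic_class mT - indic_class mB.
    by rewrite (indic_classU mCB mB mT)// addrK.
  apply: closed_spanB; last exact: PB.
  by rewrite (indic_classE mT (@measurableT _ (measurableTypeR R)))// setvU.
- move=> F mF tF PF mUF.
  have mUn n : measurable (\big[setU/set0]_(k < n) F k) by exact: bigsetU_measurable.
  apply: (closed_span_indic_lim (A_ := fun n => \big[setU/set0]_(k < n) F k)
    (mA_ := mUn)).
  + move=> t _ [k _ Fkt]; exists k.+1 => // n /= kn.
    by rewrite -bigcup_mkord; exists k.
  + by move=> n t; rewrite -bigcup_mkord => -[k _ Fkt]; exists k.
  + move=> n; move: (mUn n); rewrite -/(P _); elim: n => [|n IH].
      rewrite big_ord0 => m0; have -> : indic_class m0 = 0; last exact: closed_span0.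
      by rewrite -(L2class0 R); apply/L2classP/aeW => t _ /=; rewrite indic0.
    rewrite big_ord_recr /=; apply: PU => //; [exact: (mUn n)|exact: mF|].
    rewrite -bigcup_mkord; apply/seteqP; split => t // -[[k /= kn Fk] Fn].
    by move: kn; rewrite (tF k n Logic.I Logic.I) ?ltnn//; exists t.
Qed.

Lemma closed_span_nnsfun (h : {nnsfun (measurableTypeR R) >-> R}) (f : L2fun R) :
  (forall t, I01 t -> f t = ((h t)%:C)%C) -> closed_span e (L2class f).
Proof.
move=> fh.
(* Stated for an arbitrary list of values to allow induction; it is applied to the finite range of
   [h]. *)
have key (s : seq R) : exists2 v : L2fun R,
    (forall t, v t = ((\sum_(y <- s) y * \1_(h @^-1` [set y]) t)%:C)%C) &
    closed_span e (L2class v).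
  elim: s => [|y s [v vE ev]].
    exists 0; last by rewrite L2class0; exact: closed_span0.
    by move=> t; rewrite big_nil.
  have mh : measurable (h @^-1` [set y]) by exact: measurable_sfunP.
  exists (L2fun_scale (y%:C)%C (toL2fun (sqint_indic mh)) + v).
    move=> t; transitivity ((y%:C * (\1_(h @^-1` [set y]) t)%:C)%C + v t) => //.
    by rewrite vE big_cons rmorphD rmorphM.
  rewrite L2classD L2classZ; apply: closed_spanD => //.
  exact/closed_spanZ/closed_span_indic.
have [v vE ev] := key (finmap.enum_fset (fset_set (range h))).
rewrite (_ : L2class f = L2class v)//; apply/L2classP/aeW => t tI.
by rewrite fh// vE fimfunE fsbig_finite.
Qed.

(** Simple functions [0 <= h n <= g] tend to [g] pointwise, and [g ^+ 2] dominates the squared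
    errors. *)
Lemma closed_span_ge0 g (sg : square_integrable (fun t => ((g t)%:C)%C)) :
  (forall t, I01 t -> 0 <= g t) -> closed_span e (L2class (toL2fun sg)).
Proof.
move=> g0; have mg : measurable_fun I01 (EFin \o g).
  by apply/measurable_EFinP; case: sg.
have ig : mu.-integrable I01 (EFin \o (fun t => g t ^+ 2)).
  have := sqint_comp sg; congr (_.-integrable _ _).
  by apply/funext => t; rewrite /= expr0n addr0.
have g0E (t : measurableTypeR R) : I01 t -> (0 <= (EFin \o g) t)%E.
  by move=> tI; rewrite lee_fin g0.
pose h := nnsfun_approx (@measurable_I01 R) mg.
have h0 n t : 0 <= h n t by [].
have hg n t : I01 t -> h n t <= g t.
  by move=> tI; rewrite /h nnsfun_approxE -lee_fin; exact: le_approx.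
have sh n : square_integrable (fun t => ((h n t)%:C)%C).
  apply: (sqint_real_le _ ig) => [|t tI].
    have mh : measurable_fun (setT : set (measurableTypeR R)) (h n).
      exact: (@measurable_funPT _ _ _ _ (h n)).
    exact: measurable_funTS mh.
  by rewrite lerXn2r ?nnegrE ?g0 ?hg.
apply: (@closed_span_real_dominated (fun n => h n) g (fun t => g t ^+ 2) sh sg ig).
- move=> n t tI; rewrite lerXn2r ?nnegrE ?g0 ?subr_ge0 ?hg//.
  by rewrite gerBl.
- move=> t tI; have /fine_cvgP[_] := cvg_nnsfun_approx (@measurable_I01 R) mg g0E tI.
  by [].
- by move=> n; apply: (@closed_span_nnsfun (h n)).
Qed.

(** Split into real and imaginary parts, then into positive and negative parts; the squared modulus
    of [u] dominates the square of each. *)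
Theorem closed_span_L2 (x : L2 R) : closed_span e x.
Proof.
rewrite -[x]L2class_repr; set u := repr x.
have [mr mi foo] := L2funP u; have iu := sqint_comp (L2funP u).
have part g : measurable_fun I01 g -> (forall t, g t ^+ 2 <= sqmod (u t)) ->
    exists2 v : L2fun R, (forall t, v t = ((g t)%:C)%C) & closed_span e (L2class v).
  move=> mg gu.
  have part0 h : measurable_fun I01 h -> (forall t, 0 <= h t) ->
     (forall t, h t <= `|g t|) ->
     exists2 v : L2fun R, (forall t, v t = ((h t)%:C)%C) & closed_span e (L2class v).
    move=> mh h0 hg; have sh : square_integrable (fun t => ((h t)%:C)%C).
      apply: (sqint_real_le mh iu) => t _; apply: le_trans (gu t).
      by rewrite -[leRHS]real_normK ?num_real// lerXn2r ?nnegrE.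
    by exists (toL2fun sh) => //; apply: closed_span_ge0.
  have [t|p pE ep] := part0 (g^\+)%R (measurable_funrpos mg) (funrpos_ge0 g).
    by rewrite ge_max ler_norm normr_ge0.
  have [t|n nE en] := part0 (g^\-)%R (measurable_funrneg mg) (funrneg_ge0 g).
    by rewrite ge_max -normrN ler_norm normr_ge0.
  exists (p - n); last by rewrite L2classB; exact: closed_spanB.
  move=> t; transitivity (p t - n t) => //; rewrite pE nE -rmorphB.
  by rewrite -[in RHS](funrposBneg g).
have [t|v vE ev] := part (fun t => complex.Re (u t)) mr.
  by rewrite lerDl sqr_ge0.
have [t|w wE ew] := part (fun t => complex.Im (u t)) mi.
  by rewrite lerDr sqr_ge0.
have -> : L2class u = L2class v + ('i)%C *: L2class w.
  rewrite -L2classZ -L2classD; apply/L2classP/aeW => t _.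
  rewrite [RHS](_ : _ = v t + ('i)%C * w t)// vE wE.
  by case: (u t) => a b; congr (_ +i* _)%C => /=; ring.
exact: closed_spanD ev (closed_spanZ _ ew).
Qed.

End Closure.
End Density.

(** * Bishop operators *)

(** A sequence through all rational rays, by the countable encoding of [rat]; codes of no rational
    give the ray ending at 0. *)
Definition rational_ray (R : realType) (n : nat) : L2 R :=
  indic_class (measurable_itv `]-oo, (ratr (odflt 0 (unpickle n)) : R)[).

Lemma closed_span_rational_ray (R : realType) (x : L2 R) :
  closed_span (@rational_ray R) x.
Proof.
apply: closed_span_L2 => q; have := closed_span_gen (@rational_ray R) (pickle q).
by rewrite /rational_ray pickleK.
Qed.

(** The shift [c] lets one statement serve both operators: [c = 0] for the Bishop operator,
    [c = - alpha] for its adjoint. *)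
Lemma quasitriangular_wrot (R : realType) (phi : R -> R) (phiw : weight phi)
    (b c : R) (T : {linear L2 R -> L2 R}) :
  irrational b -> (forall t, `[0, 1[%classic t -> phi t = frac (t + c)) ->
  (forall x, T x = wrot phiw b x) -> quasitriangular T.
Proof.
move=> birr phiE TE; apply: (quasitriangular_lim_nilpotent (@closed_span_rational_ray R)).
  by exists 1 => x; rewrite mul1r TE hnorm_wrot_le.
move=> eps eps0; have [N hit] := irrational_rot_hit birr eps0.
have psiw := weight_rot c (weight_cutoff eps).
exists (wrot psiw b), N; split.
  (* The truncated weight vanishes at [t] when [frac (t + c) < eps], so the orbit to follow starts
     at [t + c]. *)
  apply: wrot_nilpotent => t tI; have [j jN jt] := hit (t + c).
  exists j => //; apply: cutoff_eq0.
  by rewrite fracfracD addrAC.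
move=> x; rewrite TE; apply: hnorm_le.
  by rewrite mulr_ge0 ?hnorm_ge0 ?ltW.
rewrite exprMn -sqnormE -[x]L2class_repr /= !wrot_class -L2classB.
apply: (@sqnorm_class_rot_le _ b) => [|t tI]; first exact: sqr_ge0.
(* The difference is again a weighted rotation, whose weight is at most [eps] in absolute value. *)
rewrite [X in sqmod X](_ : _ =
    ((phi t - cutoff eps (frac (t + c)))%:C)%C * repr x (frac (t + b))); last first.
  by rewrite rmorphB mulrBl.
rewrite sqmodM sqmod_real ler_wpM2r ?sqmod_ge0//.
rewrite -real_normK ?num_real// lerXn2r ?nnegrE ?(ltW eps0)// phiE//.
exact/cutoff_close/frac_in.
Qed.

Lemma bishopE (R : realType) (alpha : R) x :
  bishop alpha x = wrot (@weight_id R) alpha x.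
Proof. exact/L2classP/aeW. Qed.

Theorem theorem2p2 (R : realType) (alpha : R) (alpha01 : 0 < alpha < 1)
  (alpha_irr : irrational alpha) :
  biquasitriangular (bishop alpha : {linear L2 R -> L2 R}).
Proof.
have alphaN_irr : irrational (- alpha).
  apply: contra_not alpha_irr => -[q _ qE]; exists (- q) => //.
  by rewrite rmorphN /= qE opprK.
split.
  apply: (quasitriangular_wrot (c := 0) alpha_irr _ (bishopE alpha)) => t tI.
  by rewrite addr0 frac_id.
have w := weight_rot (- alpha) (@weight_id R).
exists (wrot w (- alpha)); split.
  move=> x y; rewrite /= bishopE; exact: (wrot_adjoint (@weight_id R)).
exact: (quasitriangular_wrot (phiw := w) (c := - alpha) alphaN_irr).
Qed.
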